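(* Assume that $F$ is $\mu$-strongly convex with $\mu>0$ and that $f(\cdot;\xi)$ is $L$-smooth for every realization of $\xi$. Let $w_*=\arg\min_wF(w)$ and $\kappa=\frac{L}{\mu}$. Then for all $w\in\mathbb{R}^d$, $$\mathbb{E}[\|\nabla f(w;\xi)\|^2]\le4L\kappa[F(w)-F(w_* )]+N,\qquad\text{where }N=2\mathbb{E}[\|\nabla f(w_*;\xi)\|^2].$$
   Context: $\xi$ is a random variable, $f(\cdot;\xi):\mathbb{R}^d\to\mathbb{R}$ is differentiable for every realization of $\xi$, $F(w)=\mathbb{E}[f(w;\xi)]$, and $\mathbb{E}[\nabla f(w;\xi)]=\nabla F(w)$ for every fixed $w\in\mathbb{R}^d$. The norm is Euclidean. $\mu$-strong convexity of $F$: $F(w)-F(w')\ge\langle\nabla F(w'),w-w'\rangle+\frac{\mu}{2}\|w-w'\|^2$ for all $w,w'\in\mathbb{R}^d$. $L$-smoothness of $f(\cdot;\xi)$ (with $L>0$ independent of the realization): $\|\nabla f(w;\xi)-\nabla f(w';\xi)\|\le L\|w-w'\|$ for all $w,w'$. *)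

(* Defs.v *)
From HB Require Import structures.
From mathcomp Require Import all_boot all_order all_algebra.
From mathcomp Require Import all_classical all_reals all_analysis.

Set Implicit Arguments.
Unset Strict Implicit.
Unset Printing Implicit Defensive.

Import Order.TTheory GRing.Theory Num.Theory.
Import numFieldNormedType.Exports.

Local Open Scope classical_set_scope.
Local Open Scope ring_scope.

Definition dot (R : realType) (d : nat) (u v : 'rV[R]_d) : R :=
  \sum_(i < d) u 0 i * v 0 i.

(* The canonical norm `|u| on 'rV[R]_d is the sup norm.  It induces the same
   topology and the same notion of differentiability as [enorm], but the
   quantitative hypotheses below refer to the Euclidean norm. *)
Definition enorm (R : realType) (d : nat) (u : 'rV[R]_d) : R :=
  Num.sqrt (dot u u).

(* Meaningful only where [g] is differentiable: ['D_v g w] is a total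
   operator. *)
Definition grad (R : realType) (d : nat) (g : 'rV[R]_d -> R) (w : 'rV[R]_d)
    : 'rV[R]_d :=
  \row_(i < d) 'D_(delta_mx 0 i) g w.

(* Meaningful only when every coordinate of [X] is integrable, because of
   [fine]. *)
Definition vec_expectation (disp : measure_display) (T : measurableType disp)
    (R : realType) (P : probability T R) (d : nat) (X : T -> 'rV[R]_d)
    : 'rV[R]_d :=
  \row_(i < d) fine ('E_P[fun t => (X t 0 i)%R])%E.

(* Meaningful only when [f (xi t) w] is integrable in [t] for every [w]. *)
Definition objective (disp disp' : measure_display) (T : measurableType disp)
    (S : measurableType disp') (R : realType) (P : probability T R)
    (xi : {RV P >-> S}) (d : nat) (f : S -> 'rV[R]_d -> R) (w : 'rV[R]_d) : R :=
  fine ('E_P[fun t => f (xi t) w])%E.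

Definition strongly_convex (R : realType) (d : nat) (mu : R)
    (F : 'rV[R]_d -> R) : Prop :=
  forall w w' : 'rV[R]_d,
    F w - F w' >= dot (grad F w') (w - w') + mu / 2 * enorm (w - w') ^+ 2.

Definition smooth (R : realType) (d : nat) (L : R) (g : 'rV[R]_d -> R) : Prop :=
  forall w w' : 'rV[R]_d, enorm (grad g w - grad g w') <= L * enorm (w - w').

Definition is_argmin (R : realType) (d : nat) (F : 'rV[R]_d -> R)
    (w : 'rV[R]_d) : Prop :=
  forall w' : 'rV[R]_d, F w <= F w'.

(* Main.v *)
Require Import Defs.
From HB Require Import structures.
From mathcomp Require Import all_boot all_order all_algebra.
From mathcomp Require Import all_classical all_reals all_analysis.
From mathcomp Require Import measurable_realfun ring lra.

Set Implicit Arguments.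
Unset Strict Implicit.
Unset Printing Implicit Defensive.

Import Order.TTheory GRing.Theory Num.Theory.
Import numFieldNormedType.Exports.

Local Open Scope classical_set_scope.
Local Open Scope ring_scope.

Lemma dotC (R : realType) (d : nat) (u v : 'rV[R]_d) : dot u v = dot v u.
Proof. by apply: eq_bigr => i _; rewrite mulrC. Qed.

Lemma dotZl (R : realType) (d : nat) (a : R) (u v : 'rV[R]_d) :
  dot (a *: u) v = a * dot u v.
Proof. by rewrite /dot mulr_sumr; apply: eq_bigr => i _; rewrite mxE mulrA. Qed.

Lemma dotZr (R : realType) (d : nat) (a : R) (u v : 'rV[R]_d) :
  dot u (a *: v) = a * dot u v.
Proof. by rewrite dotC dotZl dotC. Qed.

Lemma dot_ge0 (R : realType) (d : nat) (u : 'rV[R]_d) : 0 <= dot u u.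
Proof. by apply: sumr_ge0 => i _; rewrite -expr2 sqr_ge0. Qed.

Lemma sqr_enorm (R : realType) (d : nat) (u : 'rV[R]_d) :
  enorm u ^+ 2 = dot u u.
Proof. by rewrite sqr_sqrtr // dot_ge0. Qed.

Lemma sqr_enormZ (R : realType) (d : nat) (a : R) (u : 'rV[R]_d) :
  enorm (a *: u) ^+ 2 = a ^+ 2 * enorm u ^+ 2.
Proof. by rewrite !sqr_enorm dotZl dotZr mulrA expr2. Qed.

(** In each coordinate the right side exceeds the left by the square [(u_i - 2 v_i)^2]. *)
Lemma sqr_enorm_le_double (R : realType) (d : nat) (u v : 'rV[R]_d) :
  enorm u ^+ 2 <= 2 * enorm (u - v) ^+ 2 + 2 * enorm v ^+ 2.
Proof.
rewrite !sqr_enorm /dot !mulr_sumr -big_split ler_sum //= => i _.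
rewrite !mxE.
have := sqr_ge0 (u 0 i - 2 * v 0 i).
lra.
Qed.

(* Compare the bounds at [w] and at [w0] based at [z = w0 + s (w - w0)]: their
   convex combination with weights [s] and [1 - s] cancels the gradient at
   [z].  As [F w0 <= F z], this yields [(1 - s) mu / 2 |w - w0|^2 <= F w - F w0]
   for every [s], without computing the gradient at the minimizer. *)
Lemma strongly_convex_quadratic_growth (R : realType) (d : nat) (mu : R)
    (F : 'rV[R]_d -> R) (w0 w : 'rV[R]_d) :
  strongly_convex mu F -> is_argmin F w0 ->
  mu / 2 * enorm (w - w0) ^+ 2 <= F w - F w0.
Proof.
move=> F_sc w0_min; set b := mu / 2 * _.
have growth s : 0 < s < 1 -> (1 - s) * b <= F w - F w0.
  move=> /andP[s_gt0 s_lt1]; set z := w0 + s *: (w - w0).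
  have wz : w - z = (1 - s) *: (w - w0).
    by rewrite /z opprD addrA scalerBl scale1r.
  have w0z : w0 - z = (- s) *: (w - w0).
    by rewrite /z opprD addrA subrr add0r scaleNr.
  have := F_sc w z; have := F_sc w0 z.
  rewrite wz w0z !dotZr !sqr_enormZ.
  rewrite [mu / 2 * _]mulrCA [mu / 2 * (_ * _)]mulrCA -/b => h0 h1.
  have h2 := w0_min z.
  (* With the goal scaled by [s], the weighted sum of [h0] and [h1] matches it: the quadratic terms
     add up to [((1 - s) s^2 + s (1 - s)^2) b = s (1 - s) b], and the right sides to
     [s (F w - F w0) + (F w0 - F z)], whose last bracket is nonpositive by [h2]. *)
  rewrite -(ler_pM2l s_gt0).
  have {}h0 : (1 - s) * ((- s) * dot (grad F z) (w - w0) + (- s) ^+ 2 * b)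
              <= (1 - s) * (F w0 - F z).
    by rewrite ler_pM2l // subr_gt0.
  have {}h1 : s * ((1 - s) * dot (grad F z) (w - w0) + (1 - s) ^+ 2 * b)
              <= s * (F w - F z).
    by rewrite ler_pM2l.
  lra.
clearbody b.
have Fw_ge : F w0 <= F w := w0_min w.
rewrite leNgt; apply/negP => lt_b.
have b_gt0 : 0 < b by lra.
(* This replaces the limit [s -> 0]: with [D = F w - F w0 < b], this [s] gives
   [(1 - s) b = (b + D) / 2 > D], against [growth]. *)
pose s := (b - (F w - F w0)) / (2 * b).
have sb : s * b = (b - (F w - F w0)) / 2 by rewrite /s; field; rewrite gt_eqF.
have : 0 < s < 1.
  apply/andP; split; first by rewrite divr_gt0 ?mulr_gt0 ?subr_gt0.
  by rewrite ltr_pdivrMr ?mulr_gt0 //; lra.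
by move=> /growth; rewrite mulrBl mul1r sb; lra.
Qed.

Lemma measurable_sqr_enorm (R : realType) (d : nat) (disp : measure_display)
    (T : measurableType disp) (X : T -> 'rV[R]_d) :
  (forall i, measurable_fun [set: T] (fun t => X t 0 i)) ->
  measurable_fun [set: T] (fun t => enorm (X t) ^+ 2).
Proof.
move=> mX.
under eq_fun do rewrite sqr_enorm.
by apply: measurable_sum => i; exact: measurable_funM.
Qed.

Theorem lemma2 (R : realType) (d : nat)
    (disp disp' : measure_display)
    (T : measurableType disp) (S : measurableType disp')
    (P : probability T R) (xi : {RV P >-> S})
    (f : S -> 'rV[R]_d -> R) (mu L : R) (wstar : 'rV[R]_d)
    (f_diff : forall (t : T) (w : 'rV[R]_d), differentiable (f (xi t)) w)
    (f_int : forall w : 'rV[R]_d,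
       P.-integrable [set: T] (fun t => (f (xi t) w)%:E))
    (F_diff : forall w : 'rV[R]_d, differentiable (objective xi f) w)
    (grad_int : forall (w : 'rV[R]_d) (i : 'I_d),
       P.-integrable [set: T] (fun t => (grad (f (xi t)) w 0 i)%:E))
    (grad_unbiased : forall w : 'rV[R]_d,
       vec_expectation P (fun t => grad (f (xi t)) w) = grad (objective xi f) w)
    (mu_gt0 : 0 < mu) (F_sc : strongly_convex mu (objective xi f))
    (L_gt0 : 0 < L) (f_smooth : forall t : T, smooth L (f (xi t)))
    (wstar_min : is_argmin (objective xi f) wstar) :
  let F := objective xi f in
  let kappa := L / mu in
  let N := (2%:E * 'E_P[fun t => (enorm (grad (f (xi t)) wstar) ^+ 2)%R])%E in
  forall w : 'rV[R]_d,
    ('E_P[fun t => (enorm (grad (f (xi t)) w) ^+ 2)%R]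
       <= (4 * L * kappa * (F w - F wstar))%:E + N)%E.
Proof.
move=> F kappa N w.
have mG v : measurable_fun [set: T]
    (fun t => (enorm (grad (f (xi t)) v) ^+ 2)%:E).
  apply/measurable_EFinP; apply: measurable_sqr_enorm => i.
  by apply/measurable_EFinP; exact: measurable_int (grad_int v i).
have sqr_ge0E v t : (0 <= (enorm (grad (f (xi t)) v) ^+ 2)%:E)%E.
  by rewrite lee_fin sqr_ge0.
have c_ge0 : 0 <= 4 * L * kappa * (F w - F wstar).
  by rewrite mulr_ge0 ?subr_ge0 // mulr_ge0 ?divr_ge0 ?mulr_ge0 // ltW.
(* The bound already holds for each realization, since the growth of [F] does not depend on [t];
   only the term at [wstar] stays random, and it integrates to [N]. *)
have pointwise t : enorm (grad (f (xi t)) w) ^+ 2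
    <= 4 * L * kappa * (F w - F wstar)
       + 2 * enorm (grad (f (xi t)) wstar) ^+ 2.
  apply: le_trans (sqr_enorm_le_double _ (grad (f (xi t)) wstar)) _.
  rewrite lerD2r.
  have h : enorm (grad (f (xi t)) w - grad (f (xi t)) wstar) ^+ 2
      <= L ^+ 2 * enorm (w - wstar) ^+ 2.
    rewrite -exprMn ler_sqr ?nnegrE ?sqrtr_ge0 ?f_smooth //.
    by rewrite mulr_ge0 ?sqrtr_ge0 ?ltW.
  have growth := strongly_convex_quadratic_growth w F_sc wstar_min.
  (* As [kappa = L / mu], the factor [4 L kappa] turns the growth constant [mu / 2] into [2 L^2],
     which is what doubling and smoothness produce. *)
  have Lkappa_gt0 : 0 < 4 * L * kappa by rewrite !mulr_gt0 ?invr_gt0.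
  move: growth; rewrite -(ler_pM2l Lkappa_gt0).
  have -> : 4 * L * kappa * (mu / 2 * enorm (w - wstar) ^+ 2)
            = 2 * (L ^+ 2 * enorm (w - wstar) ^+ 2).
    by rewrite /kappa; field; rewrite gt_eqF.
  by apply: le_trans; rewrite ler_pM2l.
(* [N] may be infinite, so linearity and monotonicity are used in their versions for nonnegative
   measurable functions. *)
rewrite /N unlock -ge0_integralZl //.
(* [P] has total mass one, so the constant is its own integral; [c_ge0] makes it a nonnegative
   integrand. *)
have -> : (4 * L * kappa * (F w - F wstar))%:E
    = (\int[P]_t (cst (4 * L * kappa * (F w - F wstar))%:E t))%E.
  by rewrite integral_cst // [X in (_ * X)%E]probability_setT mule1.
rewrite -ge0_integralD //; last 2 first.
- by move=> t _; rewrite mule_ge0.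
- exact: measurable_funeM.
apply: ge0_le_integral => //.
- by apply: emeasurable_funD => //; exact: measurable_funeM.
by move=> t _; rewrite /= -EFinM -EFinD lee_fin.
Qed.
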